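(* Let $R$ be an infinite principal ideal domain that is not a field and whose set of units $U(R)$ is finite. Then $R$ has infinitely many maximal ideals.
   Context: $U(R)$ denotes the set of units of $R$. *)

(* Defs.v *)
From HB Require Import structures.
From mathcomp Require Export all_boot all_order all_algebra.
From mathcomp Require Export boolp classical_sets functions cardinality.

Set Implicit Arguments.
Unset Strict Implicit.
Unset Printing Implicit Defensive.

Import GRing.Theory.

Local Open Scope classical_set_scope.
Local Open Scope ring_scope.

(* The library's [idealr_closed] is not used: it excludes the unit ideal. *)
Definition is_ideal (R : comNzRingType) (I : set R) : Prop :=
  [/\ I 0,
      forall x y : R, I x -> I y -> I (x + y) &
      forall a x : R, I x -> I (a * x)].

Definition is_principal (R : comNzRingType) (I : set R) : Prop :=
  exists a : R, I = [set r * a | r in [set: R]].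

Definition is_pid (R : idomainType) : Prop :=
  forall I : set R, is_ideal I -> is_principal I.

Definition maximal_ideal (R : comNzRingType) (M : set R) : Prop :=
  [/\ is_ideal M, M <> [set: R] &
      forall J : set R, is_ideal J -> M `<=` J -> J = M \/ J = [set: R]].

Definition units (R : unitRingType) : set R :=
  [set u | u \is a GRing.unit].

Arguments units R : clear implicits.

(* Main.v *)
Require Import Defs.

(** If there were only finitely many maximal ideals, all of them nonzero since
    [R] is not a field, then their intersection would contain some [p <> 0].
    For every [r] the element [1 + r * p] avoids all maximal ideals, so it is a
    unit, and [r |-> 1 + r * p] embeds the infinite ring [R] into its finite set
    of units. *)

Set Implicit Arguments.
Unset Strict Implicit.
Unset Printing Implicit Defensive.

Import GRing.Theory.

Local Open Scope classical_set_scope.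
Local Open Scope ring_scope.

Lemma principal_is_ideal (R : comNzRingType) (x : R) :
  is_ideal [set r * x | r in [set: R]].
Proof.
split; first by exists 0; rewrite ?mul0r.
- by move=> _ _ [r _ <-] [s _ <-]; exists (r + s); rewrite ?mulrDl.
- by move=> a _ [r _ <-]; exists (a * r); rewrite ?mulrA.
Qed.

Lemma ideal_1_setT (R : comNzRingType) (I : set R) :
  is_ideal I -> I 1 -> I = [set: R].
Proof.
move=> [_ _ IM] I1; rewrite -subTset => y _.
by rewrite -[y]mulr1; apply: IM.
Qed.

Lemma maximal_ideal_not1 (R : comNzRingType) (M : set R) :
  maximal_ideal M -> ~ M 1.
Proof. by move=> [Mideal MT _] /(ideal_1_setT Mideal). Qed.

(** Zorn's lemma among the ideals that contain [x] and avoid [1]; the ideal generated by [x] is one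
    of them because [x] is not a unit. *)
Lemma nonunit_in_maximal_ideal (R : comUnitRingType) (x : R) :
  x \isn't a GRing.unit -> exists2 M : set R, maximal_ideal M & M x.
Proof.
move=> xNunit.
(* The last clause replaces [I x], because Zorn's lemma requires the union of
   the empty chain to satisfy the property. *)
pose P (I : set R) := [/\ forall y z, I y -> I z -> I (y + z),
  forall a y, I y -> I (a * y), ~ I 1 & forall y, I y -> I x].
have ideal_P (I : set R) : is_ideal I -> ~ I 1 -> I x -> P I.
  by move=> [_ ID IM] I1 Ix; split.
have [F FP Ftot|M [[MD MM M1 Mx] Mmax]] := @Zorn_bigcup R P.
  split.
  - move=> y z [I FI Iy] [J FJ Jz].
    have [IJ|JI] := Ftot _ _ FI FJ.
    + by exists J => //; have [JD _ _ _] := FP _ FJ; apply: JD => //; apply: IJ.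
    + by exists I => //; have [ID _ _ _] := FP _ FI; apply: ID => //; apply: JI.
  - move=> a y [I FI Iy]; exists I => //.
    by have [_ IM _ _] := FP _ FI; apply: IM.
  - by move=> [I FI I1]; have [_ _ + _] := FP _ FI; apply.
  - move=> y [I FI Iy]; exists I => //.
    by have [_ _ _ Ix] := FP _ FI; apply: Ix Iy.
(* If [x] were not in [M], then [M] would be empty, and the ideal generated by [x] would be a
   strictly larger set satisfying [P]. *)
have {}Mx : M x.
  apply: contrapT => MNx.
  have xRx : [set r * x | r in [set: R]] x by exists 1; rewrite ?mul1r.
  apply: (Mmax [set r * x | r in [set: R]]).
    by split=> [y /Mx //|/(_ _ xRx)].
  apply: ideal_P => //; first exact: principal_is_ideal.
  move=> [r _ rx1]; move/negP: xNunit; apply.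
  by apply/unitrP; exists r; rewrite [x * r]mulrC.
exists M => //; split.
- by split=> //; rewrite -(mul0r x); apply: MM.
- by move=> MT; apply: M1; rewrite MT.
move=> J Jideal MJ; have [J1|J1] := pselect (J 1).
  by right; apply: ideal_1_setT.
left; apply: contrapT => JM; apply: (Mmax J).
  by split=> // JsubM; apply: JM; apply/seteqP.
by apply: ideal_P => //; apply: MJ.
Qed.

(** If [M] were zero, it would lie in the principal ideal of any [x != 0]; by maximality that ideal
    would be all of [R], making [x] a unit and [R] a field. *)
Lemma maximal_ideal_neq0 (R : idomainType) (M : set R) :
  ~ GRing.field_axiom R -> maximal_ideal M -> exists2 m, m != 0 & M m.
Proof.
move=> Rnotfield [[M0 _ _] _ Mmax].
apply: contrapT => noM; apply: Rnotfield => x x0.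
have xRx : [set r * x | r in [set: R]] x by exists 1; rewrite ?mul1r.
have [|xRM|xRT] := Mmax _ (principal_is_ideal x).
- move=> m Mm; have [->|m0] := eqVneq m 0; first by exists 0; rewrite ?mul0r.
  by exfalso; apply: noM; exists m.
- by exfalso; apply: noM; exists x => //; rewrite -xRM.
have [r _ rx1] : [set r * x | r in [set: R]] 1 by rewrite xRT.
by apply/unitrP; exists r; rewrite [x * r]mulrC.
Qed.

(** Multiply one nonzero element from each ideal: the product lies in all of them, and is nonzero in
    a domain. *)
Lemma finite_ideals_common_neq0 (R : idomainType) (S : set (set R)) :
  finite_set S ->
  (forall I, S I -> is_ideal I /\ exists2 m, m != 0 & I m) ->
  exists2 p, p != 0 & forall I, S I -> I p.
Proof.
move=> /finite_seqP [s ->].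
elim: s => [_|I s IHs HS]; first by exists 1; rewrite ?oner_neq0.
have [J Js|p p0 ps] := IHs; first by apply: HS; rewrite /= inE Js orbT.
have [|_ [m m0 Im]] := HS I; first by rewrite /= mem_head.
exists (p * m) => [|J Js]; first by rewrite mulf_neq0.
have [[_ _ JM] _] := HS J Js.
move: Js; rewrite /= inE => /orP[/eqP JI|Js].
  by apply: JM; rewrite JI.
by rewrite mulrC; apply: JM; apply: ps.
Qed.

Theorem proposition3p17 (R : idomainType)
    (R_infinite : infinite_set [set: R])
    (R_pid : is_pid R)
    (R_not_field : ~ GRing.field_axiom R)
    (units_finite : finite_set (units R)) :
  infinite_set [set M : set R | maximal_ideal M].
Proof.
move=> maxfin; apply: R_infinite.
have [M Mmax|p p0 pM] := finite_ideals_common_neq0 maxfin.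
  by split; [case: Mmax | apply: maximal_ideal_neq0].
have unit1p r : 1 + r * p \is a GRing.unit.
  apply: contrapT => /negP /nonunit_in_maximal_ideal [M Mmax M1p].
  have [[_ MD MM] _ _] := Mmax; apply: (maximal_ideal_not1 Mmax).
  (* Here [1] is written as [(1 + r * p) + (- r) * p], a sum of two elements of [M]. *)
  rewrite -(addrK (r * p) 1) -mulNr; apply: MD => //.
  by apply: MM; apply: pM.
have inj1p : injective (fun r : R => 1 + r * p).
  by move=> r s /addrI /(mulIf p0).
apply: (@sub_finite_set _ _ ((fun r : R => 1 + r * p) @^-1` units R)).
  by move=> r _; apply: unit1p.
by apply: finite_preimage => // r s _ _; apply: inj1p.
Qed.
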